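(* If $f(D,N,R):=DNR-D^2-NR^2=0$ for some $(D,N,R)\in\mathbb Z^3$ with $D>0$, $N>1$ and $R>0$, then $N=4$ and $D=2R$. In this case, $\operatorname{Orb}(D,N,R)$ is a singleton set.
   Context: Let $\nu,\sigma:\mathbb R^3\to\mathbb R^3$ be the involutions $\nu(D,N,R):=(NR-D,N,R)$ and $\sigma(D,N,R):=(D,N,D-R)$. For $(D,N,R)\in\mathbb Z^3$ with $N>1$, $\operatorname{Orb}(D,N,R)$ denotes the orbit of $(D,N,R)$ under the action of the group generated by $\nu$ and $\sigma$, i.e., the set of all triples obtained from $(D,N,R)$ by applying finitely many (possibly zero) of the maps $\nu$ and $\sigma$. *)

(* Defs.v *)
From mathcomp Require Import all_boot all_order all_algebra.
From mathcomp Require Import boolp classical_sets.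

Set Implicit Arguments.
Unset Strict Implicit.
Unset Printing Implicit Defensive.

Import GRing.Theory.
Local Open Scope ring_scope.

(* The maps are given by polynomials with integer coefficients, so they are
   defined over an arbitrary commutative ring [K]: [K] the reals gives the maps
   on R^3, and [K := int] gives their restrictions to the stable subset Z^3. *)

Definition nu (K : comNzRingType) (t : K * K * K) : K * K * K :=
  let: (D, N, R) := t in (N * R - D, N, R).

Definition sigma (K : comNzRingType) (t : K * K * K) : K * K * K :=
  let: (D, N, R) := t in (D, N, D - R).

Definition f (K : comNzRingType) (D N R : K) : K :=
  D * N * R - D ^+ 2 - N * R ^+ 2.

Lemma nuK (K : comNzRingType) : involutive (@nu K).
Proof. by move=> [[D N] R] /=; rewrite subKr. Qed.

Lemma sigmaK (K : comNzRingType) : involutive (@sigma K).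
Proof. by move=> [[D N] R] /=; rewrite subKr. Qed.

(* As [nu] and [sigma] are involutions, every element of the group they
   generate is a finite composition of [nu]s and [sigma]s. *)
Inductive reachable (K : comNzRingType) (t : K * K * K) : K * K * K -> Prop :=
| reachable_refl : reachable t t
| reachable_nu u : reachable t u -> reachable t (nu u)
| reachable_sigma u : reachable t u -> reachable t (sigma u).

Definition Orb (K : comNzRingType) (t : K * K * K) : set (K * K * K) :=
  [set u | reachable t u]%classic.

(* Main.v *)
(* The equation says (2D - NR)^2 = R^2 (N^2 - 4N). Hence R divides 2D - NR and
   N^2 - 4N is a perfect square. It is negative for 1 < N < 4 and lies strictly
   between (N - 3)^2 and (N - 2)^2 for N > 4, so N = 4 and 2D = NR. *)

Require Import Defs.
From mathcomp Require Import all_boot all_order all_algebra.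
From mathcomp Require Import boolp classical_sets.
From mathcomp Require Import zify ring.

Import Order.TTheory GRing.Theory.

Local Open Scope ring_scope.

Lemma dvdz_sqr (a b : int) : (a ^+ 2 %| b ^+ 2)%Z = (a %| b)%Z.
Proof. by rewrite !dvdzE !abszX dvdn_pexp2r. Qed.

Lemma sqr_eq_subr4 (N m : int) : 1 < N -> m ^+ 2 = N ^+ 2 - 4 * N ->
  N = 4 /\ m = 0.
Proof.
move=> hN hm; have N4 : N = 4.
  (* Only the square of [m] matters; for [m >= 0] and [N > 4], bounding [m] by [N - 3] or below by
     [N - 2] bounds its square likewise. *)
  wlog m0 : m hm / 0 <= m => [hwlog|].
    have [|m_lt0] := leP 0 m; first exact: hwlog.
    by apply: (hwlog (- m)); [rewrite sqrrN | lia].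
  rewrite !expr2 in hm; have [N_lt4|N_gt4|//] := ltgtP N 4; first by nia.
  by have [m_le|m_gt] := leP m (N - 3); nia.
by split=> //; apply/eqP; rewrite -sqrf_eq0 hm N4.
Qed.

Lemma f_eq0 (D N R : int) : 1 < N -> R != 0 -> f D N R = 0 ->
  N = 4 /\ D = 2 * R.
Proof.
move=> hN hR hf.
have disc : (2 * D - N * R) ^+ 2 = (N ^+ 2 - 4 * N) * R ^+ 2.
  (* Completing the square in [D]: left side minus right side is [-4 * f D N R]. *)
  by rewrite -[RHS]subr0 -(mulr0 4) -hf /f; ring.
have /dvdzP[m hm] : (R %| 2 * D - N * R)%Z.
  by rewrite -dvdz_sqr disc dvdz_mull.
have [|N4 m0] := @sqr_eq_subr4 N m hN.
  apply: (@mulIf _ (R ^+ 2)); first by rewrite expf_neq0.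
  by rewrite -disc hm exprMn.
by split=> //; move: hm; rewrite N4 m0; lia.
Qed.

Lemma Orb_fixed (K : comNzRingType) (t : K * K * K) :
  nu t = t -> sigma t = t -> Orb t = [set t]%classic.
Proof.
move=> nut sigmat; apply/seteqP; split=> [u|_ ->]; last exact: reachable_refl.
by elim=> // v _ ->.
Qed.

Theorem theorem3p3 (D N R : int) (hD : 0 < D) (hN : 1 < N) (hR : 0 < R)
    (hf : f D N R = 0) :
  (N = 4 /\ D = 2 * R) /\
  (exists u : int * int * int, Orb (D, N, R) = [set u]%classic).
Proof.
have [N4 D2] : N = 4 /\ D = 2 * R by apply: f_eq0 => //; lia.
split=> //; exists (D, N, R); rewrite N4 D2.
(* Both involutions fix [(2 * R, 4, R)], since [4 * R - 2 * R = 2 * R] and [2 * R - R = R]. *)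
by apply: Orb_fixed; congr (_, _, _); ring.
Qed.
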